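(* Let $M$ be a closed manifold immersed in $(V,\omega)=(\mathbb{R}^{2d},\sum_i dx_i\wedge dy_i)$ satisfying condition (LL): for every $P\in V$ there exists a point $x\in M$ with $T_xM\not\subset (x-P)^\omega$. Let $L_1,L_2\subset V$ be affine Lagrangian subspaces in general position, and let $n\ge 2$. Then there exist at least two distinct non-degenerate $n$-link outer symplectic billiard trajectories connecting $L_1$ and $L_2$.
   Context: Points of $M$ are identified with their images in $V$ and $T_xM\subset V$ denotes the tangent space at $x$. For a vector $u\in V$, $u^\omega=\{\xi\in V:\omega(\xi,u)=0\}$ is the symplectic complement of $\mathbb{R}u$. For a point $Q$ of $M$, $T_Q^\omega M=\{\xi\in V:\omega(\xi,\zeta)=0\ \forall \zeta\in T_QM\}$. Two points $z,z'\in V$ are in outer symplectic billiard correspondence with respect to $M$ if $Q=\tfrac12(z+z')$ is a point of $M$ and $z'-z\in T^\omega_QM$. Two affine Lagrangian subspaces are in general position if they contain no parallel lines (their direction subspaces intersect only in $0$). An $n$-link outer symplectic billiard trajectory connecting $L_1$ and $L_2$ is a tuple $(z_1,\dots,z_{n+1})$ of points of $V$ with $z_1\in L_1$, $z_{n+1}\in L_2$, and $z_i,z_{i+1}$ in outer symplectic billiard correspondence for each $i=1,\dots,n$. It is degenerate if $z_{i-1}=z_{i+1}$ for some $i\in\{2,\dots,n\}$, and non-degenerate otherwise. *)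

(* Defs.v *)
From HB Require Import structures.
From mathcomp Require Import all_boot all_order all_algebra.
From mathcomp Require Import all_classical all_reals all_analysis.
Set Implicit Arguments. Unset Strict Implicit. Unset Printing Implicit Defensive.
Import Order.TTheory GRing.Theory Num.Theory.
Import numFieldNormedType.Exports.
Local Open Scope classical_set_scope.
Local Open Scope ring_scope.

Section Defs.
Variable R : realType.

Definition omega (d : nat) (u v : 'rV[R]_(d + d)) : R :=
  \sum_(i < d) (u 0 (lshift d i) * v 0 (rshift d i)
                - u 0 (rshift d i) * v 0 (lshift d i)).

Fixpoint iterD (k m : nat) (vs : seq 'rV[R]_k) (g : 'rV[R]_k -> 'rV[R]_m)
  : 'rV[R]_k -> 'rV[R]_m :=
  match vs with
  | [::] => g
  | v :: vs' => fun x => 'D_v (iterD vs' g) x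
  end.

Definition smooth_on (k m : nat) (A : set 'rV[R]_k) (g : 'rV[R]_k -> 'rV[R]_m)
  : Prop :=
  forall vs : seq 'rV[R]_k, forall x, A x ->
    {for x, continuous (iterD vs g)} /\ forall v, derivable (iterD vs g) x v.

(* A chart of the abstract manifold N (a homeomorphism phi from an open set
   W of R^k onto an open subset of N) in which f is a smooth immersion. *)
Definition immersion_chart (N : topologicalType) (k d : nat)
  (f : N -> 'rV[R]_(d + d)) (W : set 'rV[R]_k) (phi : 'rV[R]_k -> N) : Prop :=
  open W /\
  [/\ (forall a b, W a -> W b -> phi a = phi b -> a = b),
      (forall w, W w -> {for w, continuous phi}),
      (forall O, open O -> O `<=` W -> open (phi @` O)),
      smooth_on W (f \o phi)
    & (forall w, W w -> forall v, 'D_v (f \o phi) w = 0 -> v = 0)].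

(* f : N -> V is a smooth immersion of the closed (compact, boundaryless)
   k-dimensional manifold N: N is compact Hausdorff and covered by charts
   in which f is a smooth immersion (this determines the smooth structure). *)
Definition closed_immersion (N : topologicalType) (k d : nat)
  (f : N -> 'rV[R]_(d + d)) : Prop :=
  [/\ hausdorff_space N, compact [set: N]
    & forall p : N, exists (W : set 'rV[R]_k) (phi : 'rV[R]_k -> N),
        immersion_chart f W phi /\ exists2 w, W w & phi w = p].

Definition tangent (N : topologicalType) (k d : nat)
  (f : N -> 'rV[R]_(d + d)) (q : N) (xi : 'rV[R]_(d + d)) : Prop :=
  exists (W : set 'rV[R]_k) (phi : 'rV[R]_k -> N) w v,
    [/\ immersion_chart f W phi, W w, phi w = q & xi = 'D_v (f \o phi) w].

Definition cond_LL (N : topologicalType) (k d : nat)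
  (f : N -> 'rV[R]_(d + d)) : Prop :=
  forall P : 'rV[R]_(d + d), exists q : N, exists xi,
    tangent k f q xi /\ omega xi (f q - P) != 0.

Definition lagrangian (d : nat) (W : 'M[R]_(d + d)) : Prop :=
  \rank W = d /\
  forall u v : 'rV[R]_(d + d), (u <= W)%MS -> (v <= W)%MS -> omega u v = 0.

Definition in_affine (d : nat) (a : 'rV[R]_(d + d)) (W : 'M[R]_(d + d))
  (z : 'rV[R]_(d + d)) : Prop := (z - a <= W)%MS.

Definition general_position (d : nat) (W1 W2 : 'M[R]_(d + d)) : Prop :=
  (W1 :&: W2 == (0 : 'M[R]_(d + d)))%MS.

Definition osb_corr (N : topologicalType) (k d : nat)
  (f : N -> 'rV[R]_(d + d)) (z z' : 'rV[R]_(d + d)) : Prop :=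
  exists q : N, f q = 2^-1 *: (z + z') /\
    forall zeta, tangent k f q zeta -> omega (z' - z) zeta = 0.

(* n-link trajectory z_0, ..., z_n (paper's z_1..z_{n+1}) *)
Definition osb_trajectory (N : topologicalType) (k d : nat)
  (f : N -> 'rV[R]_(d + d)) (a1 : 'rV[R]_(d + d)) (W1 : 'M[R]_(d + d))
  (a2 : 'rV[R]_(d + d)) (W2 : 'M[R]_(d + d)) (n : nat)
  (z : nat -> 'rV[R]_(d + d)) : Prop :=
  [/\ in_affine a1 W1 (z 0%N), in_affine a2 W2 (z n)
    & forall i, (i < n)%N -> osb_corr k f (z i) (z i.+1)].

Definition osb_nondegenerate (d n : nat) (z : nat -> 'rV[R]_(d + d)) : Prop :=
  forall i, (1 <= i)%N -> (i < n)%N -> z i.-1 <> z i.+1.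

End Defs.

(* Main.v *)
Require Import Defs.
From HB Require Import structures.
From mathcomp Require Import all_boot all_order all_algebra.
From mathcomp Require Import all_classical all_reals all_analysis.
From mathcomp Require Import ring lra zify.
Import Order.TTheory GRing.Theory Num.Theory.
Import numFieldNormedType.Exports ArrowAsProduct.
Set Implicit Arguments. Unset Strict Implicit. Unset Printing Implicit Defensive.
Local Open Scope classical_set_scope.
Local Open Scope ring_scope.

(** Since the directions of L_1 and L_2 are complementary, midpoints Q_1, ..., Q_n
    chosen freely on M determine a unique path from L_1 to L_2, and the
    trajectories are the critical points of a quadratic "action" of the midpoints.
    The action is continuous on the compact space of midpoint sequences, so it has a
    maximum and a minimum.  If z_{i-1} = z_{i+1} at an extremum, then
    Q_{i-1} = Q_i may be moved along all of M without changing the action; all the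
    resulting paths are extremal, hence critical, which contradicts (LL) at
    P = z_{i-1}.  As degenerate paths are therefore never extremal, the action is not
    constant, and the two extrema give different trajectories. *)

(** * The symplectic form, Lagrangian directions and limits *)

Section SymplecticForm.
Context {R : realType} {d : nat}.
Implicit Types (u v w x : 'rV[R]_(d + d)) (W : 'M[R]_(d + d)).

Lemma omegaC u v : omega u v = - omega v u.
Proof.
by rewrite /omega -sumrN; apply: eq_bigr => i _; ring.
Qed.

Lemma omegaDl u v w : omega (u + v) w = omega u w + omega v w.
Proof.
by rewrite /omega -big_split; apply: eq_bigr => i _; rewrite !mxE /=; ring.
Qed.

Lemma omegaZl c u v : omega (c *: u) v = c * omega u v.
Proof.
by rewrite /omega mulr_sumr; apply: eq_bigr => i _; rewrite !mxE; ring.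
Qed.

Lemma omegaDr u v w : omega u (v + w) = omega u v + omega u w.
Proof. by rewrite omegaC omegaDl opprD -!(omegaC u). Qed.

Lemma omegaZr c u v : omega u (c *: v) = c * omega u v.
Proof. by rewrite omegaC omegaZl -mulrN -omegaC. Qed.

Lemma omegaNl u v : omega (- u) v = - omega u v.
Proof. by rewrite -scaleN1r omegaZl mulN1r. Qed.

Lemma omegaNr u v : omega u (- v) = - omega u v.
Proof. by rewrite -scaleN1r omegaZr mulN1r. Qed.

Lemma omega0l u : omega 0 u = 0.
Proof. by rewrite -(scale0r 0) omegaZl mul0r. Qed.

Lemma omega0r u : omega u 0 = 0.
Proof. by rewrite omegaC omega0l oppr0. Qed.

Lemma omegaBl u v w : omega (u - v) w = omega u w - omega v w.
Proof. by rewrite omegaDl omegaNl. Qed.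

(** Here [x - a] and [u] are both directions of [W], hence orthogonal for [omega]. This is why the
    boundary terms of the action below may use fixed base points. *)
Lemma omega_affine_lagrangian W a x u : lagrangian W ->
  in_affine a W x -> (u <= W)%MS -> omega x u = omega a u.
Proof.
move=> [_ lagW] xW uW; rewrite -[x](subrK a) omegaDl.
by rewrite (lagW _ _ xW uW) add0r.
Qed.

Lemma in_affineD W a x u :
  in_affine a W x -> (u <= W)%MS -> in_affine a W (x + u).
Proof. by rewrite /in_affine addrAC => xW uW; rewrite addmx_sub. Qed.

Lemma in_affineB W a x y :
  in_affine a W x -> in_affine a W y -> (x - y <= W)%MS.
Proof.
move=> xW yW; have -> : x - y = (x - a) - (y - a) by rewrite opprB addrA subrK.
by rewrite addmx_sub ?eqmx_opp.
Qed.

Section Limits.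
Context {T : Type} {F : set_system T} {FF : Filter F}.
Implicit Types g h : T -> 'rV[R]_(d + d).

Lemma cvg_sum (V : normedModType R) (I : Type) (r : seq I)
    (g : I -> T -> V) (l : I -> V) :
  (forall i, g i x @[x --> F] --> l i) ->
  (\sum_(i <- r) g i x) @[x --> F] --> \sum_(i <- r) l i.
Proof.
move=> gl; elim: r => [|i r IHr].
  rewrite big_nil; under eq_fun do rewrite big_nil; exact: cvg_cst.
rewrite big_cons; under eq_fun do rewrite big_cons.
exact: cvgD (gl i) IHr.
Qed.

Lemma cvg_coord g u i : g x @[x --> F] --> u -> g x 0 i @[x --> F] --> u 0 i.
Proof.
move=> gu; apply: (@continuous_cvg _ _ _ F FF g (fun M => M 0 i) u) => //.
exact: coord_continuous.
Qed.

Lemma cvg_omega g h u v :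
  g x @[x --> F] --> u -> h x @[x --> F] --> v ->
  omega (g x) (h x) @[x --> F] --> omega u v.
Proof.
move=> gu hv; rewrite /omega; apply: cvg_sum => i.
by apply: cvgB; apply: cvgM; exact: cvg_coord.
Qed.

Lemma cvg_mulmxr (A : 'M[R]_(d + d)) g u :
  g x @[x --> F] --> u -> g x *m A @[x --> F] --> u *m A.
Proof.
move=> gu; rewrite mulmx_sum_row; under eq_fun do rewrite mulmx_sum_row.
by apply: cvg_sum => i; apply: cvgZl; exact: cvg_coord.
Qed.

End Limits.

End SymplecticForm.

Lemma general_position_cap (R : realType) (d : nat) (W1 W2 : 'M[R]_(d + d)) :
  general_position W1 W2 -> (W1 :&: W2)%MS = 0.
Proof. by move=> /andP[]; rewrite submx0 => /eqP. Qed.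

Lemma general_position_full (R : realType) (d : nat) (W1 W2 : 'M[R]_(d + d))
    (u : 'rV[R]_(d + d)) :
  lagrangian W1 -> lagrangian W2 -> general_position W1 W2 ->
  (u <= W1 + W2)%MS.
Proof.
move=> [r1 _] [r2 _] /general_position_cap W12.
by apply: submx_full; rewrite /row_full mxrank_disjoint_sum // r1 r2.
Qed.

Lemma signr_double (A : pzRingType) i : (-1) ^+ (i + i) = 1 :> A.
Proof. by rewrite addnn -signr_odd odd_double expr0. Qed.

(** * The action, its variations, and paths with prescribed midpoints *)

Section Action.
Context {R : realType} {d : nat}.
Variables (a1 a2 : 'rV[R]_(d + d)) (W1 W2 : 'M[R]_(d + d)).
Variable n : nat.
Hypotheses (hL1 : lagrangian W1) (hL2 : lagrangian W2).
Hypothesis (hgp : general_position W1 W2).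
Implicit Types (z h Q : nat -> 'rV[R]_(d + d)).

(* The generating function: with Q_j the midpoints, its differential on paths
   from L_1 to L_2 is sum_j 2 omega(z_{j+1} - z_j, dQ_j); the boundary terms
   absorb the contributions of the endpoints, as L_1, L_2 are Lagrangian. *)
Definition action z : R :=
  omega a2 (z n) - omega a1 (z 0%N) - \sum_(0 <= j < n) omega (z j) (z j.+1).

(** Summation by parts: the terms [omega (z j) (h j)] telescope to the endpoints, where they match
    the variation of the boundary terms of [action]. The formula is exact, second order included. *)
Lemma action_variation z h :
  in_affine a1 W1 (z 0%N) -> in_affine a2 W2 (z n) ->
  (h 0%N <= W1)%MS -> (h n <= W2)%MS ->
  action (fun j => z j + h j) - action z =
  \sum_(0 <= j < n) (omega (z j.+1 - z j) (h j + h j.+1)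
                     - omega (h j) (h j.+1)).
Proof.
move=> z0 zn h0 hn.
have <- : \sum_(0 <= j < n)
    ((omega (z j.+1) (h j.+1) - omega (z j) (h j))
     - (omega (z j + h j) (z j.+1 + h j.+1) - omega (z j) (z j.+1))) =
  \sum_(0 <= j < n) (omega (z j.+1 - z j) (h j + h j.+1)
                     - omega (h j) (h j.+1)).
  apply: eq_bigr => j _; rewrite !(omegaDl, omegaDr, omegaNl).
  by rewrite (omegaC (h j) (z j.+1)); ring.
rewrite sumrB (telescope_sumr (fun j => omega (z j) (h j))) // sumrB.
rewrite (omega_affine_lagrangian hL1 z0 h0).
rewrite (omega_affine_lagrangian hL2 zn hn) /action !omegaDr.
by ring.
Qed.

(* The variation of a path when its i-th midpoint moves by [eta]: the other
   midpoints being fixed, its vertices alternate in sign on both sides, within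
   the direction of L_1 before the i-th link and within that of L_2 after it. *)
Definition kick (eta : 'rV[R]_(d + d)) (i j : nat) : 'rV[R]_(d + d) :=
  if (j <= i)%N then (-1) ^+ (i + j) *: ((2 *: eta) *m proj_mx W1 W2)
  else (-1) ^+ (i + j).+1 *: ((2 *: eta) *m proj_mx W2 W1).

Lemma kick_first eta i : (kick eta i 0 <= W1)%MS.
Proof. by rewrite /kick leq0n scalemx_sub // proj_mx_sub. Qed.

Lemma kick_last eta i : (i < n)%N -> (kick eta i n <= W2)%MS.
Proof. by move=> lt_in; rewrite /kick leqNgt lt_in scalemx_sub // proj_mx_sub. Qed.

Lemma kick_diag eta i : kick eta i i = (2 *: eta) *m proj_mx W1 W2.
Proof. by rewrite /kick leqnn signr_double scale1r. Qed.

Lemma kick_diagS eta i : kick eta i i.+1 = (2 *: eta) *m proj_mx W2 W1.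
Proof.
rewrite /kick ltnn addnS !exprS mulrA mulrNN !mul1r.
by rewrite signr_double scale1r.
Qed.

Lemma kickD eta i : kick eta i i + kick eta i i.+1 = 2 *: eta.
Proof.
rewrite kick_diag kick_diagS add_proj_mx ?general_position_cap //.
exact: general_position_full.
Qed.

Lemma kickS eta i j : j != i -> kick eta i j.+1 = - kick eta i j.
Proof.
rewrite /kick neq_ltn => /orP[] ji.
  by rewrite ji (ltnW ji) addnS exprS mulN1r scaleNr.
by rewrite leqNgt ltnS (ltnW ji) leqNgt ji /= addnS exprS mulN1r scaleNr.
Qed.

(** Away from link [i] consecutive kicks are opposite, so that both terms of the variation vanish;
    link [i] alone gives a linear and a quadratic term in [eta]. *)
Lemma action_kick z eta i : (i < n)%N ->
  in_affine a1 W1 (z 0%N) -> in_affine a2 W2 (z n) ->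
  action (fun j => z j + kick eta i j) - action z =
  2 * omega (z i.+1 - z i) eta
  - 4 * omega (eta *m proj_mx W1 W2) (eta *m proj_mx W2 W1).
Proof.
move=> lt_in z0 zn.
rewrite action_variation ?kick_first ?kick_last //.
rewrite big_mkord (bigD1 (Ordinal lt_in)) //= big1 => [|j].
  rewrite kickD kick_diag kick_diagS -!scalemxAl !(omegaZl, omegaZr) addr0.
  by ring.
rewrite -val_eqE /= => ji; rewrite kickS // subrr omega0r omegaNr omegaC.
rewrite sub0r opprK.
have := omegaC (kick eta i j) (kick eta i j); lra.
Qed.

(** Only the two links at vertex [i] contribute. Their linear terms add up to
    [omega (z i.+1 - z i.-1) e], which is zero, and no two consecutive vertices move, so there is no
    quadratic term. *)
Lemma action_replace z i e : (0 < i)%N -> (i < n)%N -> z i.-1 = z i.+1 ->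
  in_affine a1 W1 (z 0%N) -> in_affine a2 W2 (z n) ->
  action (fun j => z j + (if j == i then e else 0)) = action z.
Proof.
case: i => // i _ lt_in /= zz z0 zn; apply/eqP; rewrite -subr_eq0.
rewrite action_variation ?sub0mx ?(gtn_eqF lt_in) ?sub0mx //.
have lt_in' := ltnW lt_in.
rewrite big_mkord (bigD1 (Ordinal lt_in)) //=.
rewrite (bigD1 (Ordinal lt_in')) /=; last first.
  by rewrite -val_eqE /= neq_ltn ltnSn.
rewrite big1 => [|j].
  rewrite !eqxx !(ltn_eqF (ltnSn _)) (gtn_eqF (ltnSn _)).
  by rewrite !omega0l !omega0r !add0r !addr0 !subr0 zz !omegaBl subrKA subrr.
rewrite -!val_eqE /= => /andP[/negPf -> ]; rewrite eqSS => /negPf ->.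
by rewrite addr0 omega0r omega0r subrr.
Qed.

(* The path with midpoints [Q] issued from the origin. *)
Fixpoint path0 Q (j : nat) : 'rV[R]_(d + d) :=
  if j is j'.+1 then 2 *: Q j' - path0 Q j' else 0.

(** Started at [a1], the path would miss [a2] by the projected vector. Shifting the start within L_1
    removes the component of this error along [W1] and leaves one along [W2]; the sign is that with
    which the shift reaches vertex [n]. *)
Definition start Q : 'rV[R]_(d + d) :=
  a1 - (-1) ^+ n *: ((path0 Q n + (-1) ^+ n *: a1 - a2) *m proj_mx W1 W2).

Definition path_of Q (j : nat) : 'rV[R]_(d + d) :=
  path0 Q j + (-1) ^+ j *: start Q.

Lemma path_of_first Q : in_affine a1 W1 (path_of Q 0).
Proof.
rewrite /in_affine /path_of /start /= add0r expr0 scale1r addrAC subrr add0r.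
by rewrite -scaleNr scalemx_sub // proj_mx_sub.
Qed.

Lemma path_of_last Q : in_affine a2 W2 (path_of Q n).
Proof.
rewrite /in_affine /path_of /start scalerBr scalerA -exprD signr_double.
rewrite scale1r addrA [X in (X <= _)%MS]addrAC.
by apply: proj_mx_compl_sub; exact: general_position_full.
Qed.

Lemma path_of_mid Q j : path_of Q j + path_of Q j.+1 = 2 *: Q j.
Proof.
by rewrite /path_of /= exprS mulN1r scaleNr addrACA subrr addr0 addrC subrK.
Qed.

(** The difference of the two paths alternates in sign, so its initial value is a direction of both
    L_1 and L_2, hence zero. *)
Lemma inscribed_path_unique z z' :
  in_affine a1 W1 (z 0%N) -> in_affine a2 W2 (z n) ->
  in_affine a1 W1 (z' 0%N) -> in_affine a2 W2 (z' n) ->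
  (forall j, (j < n)%N -> z j + z j.+1 = z' j + z' j.+1) ->
  forall j, (j <= n)%N -> z j = z' j.
Proof.
move=> z0 zn z0' zn' mid.
have alt j : (j <= n)%N -> z j - z' j = (-1) ^+ j *: (z 0%N - z' 0%N).
  elim: j => [_|j IHj lt_jn]; first by rewrite expr0 scale1r.
  rewrite exprS mulN1r scaleNr -IHj ?(ltnW lt_jn) //.
  by apply/eqP; rewrite eq_sym eqr_oppLR opprB subr_eq addrAC eq_sym subr_eq
    addrC mid // addrC.
have sub0 := in_affineB z0 z0'.
have subn : (z 0%N - z' 0%N <= W2)%MS.
  rewrite -[z 0%N - _]scale1r -(sqrr_sign R n) expr2 -scalerA -alt //.
  by rewrite scalemx_sub // (in_affineB zn zn').
have eq0 : z 0%N - z' 0%N = 0.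
  apply/eqP; rewrite -submx0 -(general_position_cap hgp).
  by rewrite sub_capmx sub0.
by move=> j le_jn; apply/eqP; rewrite -subr_eq0 alt // eq0 scaler0.
Qed.

Lemma action_ext z z' : (forall j, (j <= n)%N -> z j = z' j) ->
  action z = action z'.
Proof.
move=> eqz; rewrite /action !eqz //; congr (_ - _).
by rewrite !big_mkord; apply: eq_bigr => j _; rewrite !eqz // ltnW.
Qed.

Lemma cvg_action_path_of (T : Type) (F : set_system T) (FF : Filter F)
    (G : T -> nat -> 'rV[R]_(d + d)) Q :
  (forall j, G t j @[t --> F] --> Q j) ->
  action (path_of (G t)) @[t --> F] --> action (path_of Q).
Proof.
move=> GQ.
have c0 j : path0 (G t) j @[t --> F] --> path0 Q j.
  elim: j => [|j IHj] /=; first exact: cvg_cst.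
  by apply: cvgB => //; apply: cvgZr; exact: GQ.
have cz j : path_of (G t) j @[t --> F] --> path_of Q j.
  apply: cvgD => //; apply: cvgZr; apply: cvgB; first exact: cvg_cst.
  apply: cvgZr; apply: cvg_mulmxr; apply: cvgB; last exact: cvg_cst.
  by apply: cvgD => //; exact: cvg_cst.
apply: cvgB.
  by apply: cvgB; apply: cvg_omega => //; exact: cvg_cst.
by apply: cvg_sum => j; exact: cvg_omega.
Qed.

End Action.

(** * The first-order condition at an extremum, and continuity of the immersion *)

Lemma derive_extremum_quadratic (R : realType) (d k : nat)
    (g : 'rV[R]_k -> 'rV[R]_(d + d)) (w v : 'rV[R]_k) (p : 'rV[R]_(d + d))
    (c : R) (A B : 'M[R]_(d + d)) :
  derivable g w v ->
  (forall x, 0 <= omega p (g x - g w)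
                + c * omega ((g x - g w) *m A) ((g x - g w) *m B)) ->
  omega p ('D_v g w) = 0.
Proof.
move=> dg ge0.
pose eta (t : R) := g (t *: v + w) - g w.
pose quot (t : R) := t^-1 *: eta t.
(* For [t != 0] this is the nonnegative expression divided by [t]. The quadratic part keeps a factor
   [t] and vanishes in the limit, so the one-sided limits have opposite signs yet agree. *)
pose r (t : R) := omega p (quot t) + c * omega (quot t *m A) ((t *: quot t) *m B).
have rE t : t != 0 -> r t = t^-1 * (omega p (eta t)
    + c * omega (eta t *m A) (eta t *m B)).
  move=> t0; rewrite /r /quot scalerA divff // scale1r omegaZr.
  by rewrite -scalemxAl omegaZl; ring.
have cquot : quot t @[t --> 0^'] --> 'D_v g w by exact: dg.
have c0 : t *: quot t @[t --> 0^'] --> (0 : R) *: 'D_v g w.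
  apply: cvgZ cquot; apply: cvg_within_filter; exact: cvg_id.
have cr : r t @[t --> 0^'] --> omega p ('D_v g w).
  have -> : omega p ('D_v g w) = omega p ('D_v g w)
      + c * omega ('D_v g w *m A) ((0 *: 'D_v g w) *m B).
    by rewrite scale0r mul0mx omega0r mulr0 addr0.
  apply: cvgD; first by apply: cvg_omega => //; exact: cvg_cst.
  apply: cvgM; first exact: cvg_cst.
  by apply: cvg_omega; exact: cvg_mulmxr.
apply/eqP; rewrite eq_le; apply/andP; split.
  apply: (cvgr_to_le (cvg_dnbhs_at_left cr)).
  near=> t; have t0 : t < 0 by near: t; exact: nbhs_left_lt.
  by rewrite rE ?lt_eqF // nmulr_rle0 ?invr_lt0 //; exact: ge0.
apply: (cvgr_to_ge (cvg_dnbhs_at_right cr)).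
near=> t; have t0 : 0 < t by near: t; exact: nbhs_right_gt.
by rewrite rE ?gt_eqF // mulr_ge0 ?invr_ge0 ?(ltW t0) //; exact: ge0.
Unshelve. all: by end_near.
Qed.

Lemma closed_immersion_continuous (R : realType) (d k : nat)
    (N : topologicalType) (f : N -> 'rV[R]_(d + d)) :
  closed_immersion k f -> continuous f.
Proof.
move=> [_ _ charts] p U fU.
have [W [phi [[oW [_ _ phio smooth _]] [w Ww wp]]]] := charts p.
(* The empty list of directions gives [f \o phi] itself; openness of [phi] then transfers its
   continuity to [f]. *)
have [cf _] := smooth [::] w Ww.
have : nbhs w (W `&` (f \o phi) @^-1` U).
  apply: filterI; first exact: open_nbhs_nbhs.
  by apply: cf; rewrite /= wp.
rewrite nbhsE; case=> O [oO Ow] OWU.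
rewrite nbhs_filterE /= nbhsE; exists (phi @` O).
  split; last by exists w.
  by apply: phio => // x /OWU[].
by move=> _ [x /OWU[_ Ux] <-].
Qed.

(** * Inscribed paths and extremal trajectories *)

Section Trajectories.
Context {R : realType} {d k : nat} {N : topologicalType}.
Variable f : N -> 'rV[R]_(d + d).
Variables (a1 a2 : 'rV[R]_(d + d)) (W1 W2 : 'M[R]_(d + d)) (n : nat).
Hypotheses (hM : closed_immersion k f) (hLL : cond_LL k f).
Hypotheses (hL1 : lagrangian W1) (hL2 : lagrangian W2).
Hypothesis hgp : general_position W1 W2.
Implicit Types (q : nat -> N) (z : nat -> 'rV[R]_(d + d)).

Definition inscribed q z : Prop :=
  [/\ in_affine a1 W1 (z 0%N), in_affine a2 W2 (z n)
    & forall j, (j < n)%N -> z j + z j.+1 = 2 *: f (q j)].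

(* [s = 1] means maximal, [s = -1] minimal. *)
Definition extremal (s : R) q z : Prop :=
  inscribed q z /\ forall q' z', inscribed q' z' ->
    s * action a1 a2 n z' <= s * action a1 a2 n z.

Lemma inscribed_path_of q : inscribed q (path_of a1 a2 W1 W2 n (f \o q)).
Proof.
split; [exact: path_of_first | exact: path_of_last |].
by move=> j _; exact: path_of_mid.
Qed.

Lemma inscribed_action q z z' : inscribed q z -> inscribed q z' ->
  action a1 a2 n z = action a1 a2 n z'.
Proof.
move=> [z0 zn zq] [z0' zn' zq']; apply: action_ext.
apply: (inscribed_path_unique _ z0 zn z0' zn') => // j lt_jn.
by rewrite zq // zq'.
Qed.

Lemma action_path_of_continuous :
  continuous ((fun q => action a1 a2 n (path_of a1 a2 W1 W2 n (f \o q)))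
    : (nat -> N) -> R).
Proof.
move=> q.
have cf j : f (q' j) @[q' --> (q : nat -> N)] --> f (q j).
  apply: (@cvg_comp _ _ _ (fun q' : nat -> N => q' j) f);
    last exact: closed_immersion_continuous hM (q j).
  exact: (@proj_continuous nat (fun _ => N) j q).
apply: (@cvg_action_path_of R d a1 a2 W1 W2 n (nat -> N) (nbhs q) _
  (fun q' j => f (q' j)) (fun j => f (q j))) => j.
exact: cf.
Qed.

Lemma cond_LL_inhabited : inhabited N.
Proof. by have [q _] := hLL 0. Qed.

(** Midpoints are indexed by all of [nat], so that Tychonoff gives compactness. A maximum over [q]
    is one over all inscribed paths, since the midpoints determine the action. *)
Lemma extremal_exists s : exists q z, extremal s q z.
Proof.
have [q0] := cond_LL_inhabited.
have [_ cN _] := hM.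
have [] := @compact_EVT_max (nat -> N) R
  (fun q => s * action a1 a2 n (path_of a1 a2 W1 W2 n (f \o q)))
  [set q | forall j, [set: N] (q j)].
- by exists (fun=> q0).
- exact: (@tychonoff nat (fun=> N) (fun=> [set: N]) (fun=> cN)).
- apply: continuous_subspaceT => q; apply: (@cvgM _ _ (nbhs q) _ (fun=> s)).
    exact: cvg_cst.
  exact: action_path_of_continuous.
move=> q _ qmax; exists q, (path_of a1 a2 W1 W2 n (f \o q)).
split; first exact: inscribed_path_of.
move=> q' z' q'z'; rewrite (inscribed_action q'z' (inscribed_path_of q')).
by apply: qmax; rewrite inE.
Qed.

Lemma extremal_critical s q z i xi : s != 0 -> extremal s q z -> (i < n)%N ->
  tangent k f (q i) xi -> omega (z i.+1 - z i) xi = 0.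
Proof.
move=> s0 [[z0 zn zq] ext] lt_in.
move=> [W [phi [w [v [[_ [_ _ _ smooth _]] Ww qi ->]]]]].
have [_ df] := smooth [::] w Ww.
pose eta x := f (phi x) - f (phi w).
(* Only midpoint [i] moves, along the chart; [phi x] lies in [N] for every [x], so extremality
   applies for every [x]. *)
pose q' x j := if j == i then phi x else q j.
have ins x : inscribed (q' x) (fun j => z j + kick W1 W2 (eta x) i j).
  split; [exact/in_affineD/kick_first|exact/in_affineD/kick_last|].
  move=> j lt_jn; rewrite addrACA zq // /q'; case: eqP => [->|/eqP ji].
    by rewrite kickD // -scalerDr /eta -qi addrC subrK.
  by rewrite kickS // subrr addr0.
have : omega (- (s *: (z i.+1 - z i))) ('D_v (f \o phi) w) = 0.
  (* The constants come from [action_kick], multiplied by [- s / 2]. *)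
  apply: (@derive_extremum_quadratic _ _ _ _ _ _ _ (s * 2)
    (proj_mx W1 W2) (proj_mx W2 W1) (df v)) => x /=.
  have := ext _ _ (ins x); rewrite -subr_ge0 -mulrBr -opprB.
  rewrite action_kick // -/(eta x) omegaNl omegaZl.
  set o1 := omega _ _; set o2 := omega _ _; lra.
by rewrite omegaNl omegaZl => /eqP; rewrite oppr_eq0 mulf_eq0 (negPf s0) => /eqP.
Qed.

Lemma extremal_trajectory s q z : s != 0 -> extremal s q z ->
  osb_trajectory k f a1 W1 a2 W2 n z.
Proof.
move=> s0 ext; have [[z0 zn zq] _] := ext; split=> // i lt_in.
exists (q i); split; first by rewrite zq // scalerA mulVf ?scale1r // pnatr_eq0.
by move=> xi; exact: extremal_critical ext lt_in.
Qed.

Lemma extremal_nondegenerate s q z : s != 0 -> extremal s q z ->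
  osb_nondegenerate n z.
Proof.
move=> s0 [[z0 zn zq] ext] i i_gt0 lt_in zz.
have [p [xi [pxi]]] := hLL (z i.-1); case/eqP.
(* Chosen so that [f p] is the midpoint of [z i.-1] and [z i + e], and thus also of [z i + e] and
   [z i.+1]. *)
pose e := 2 *: f p - z i.-1 - z i.
pose z' j := z j + (if j == i then e else 0).
pose q' j := if (j == i) || (j == i.-1) then p else q j.
have ins : inscribed q' z'.
  rewrite /z'; split.
  - by rewrite ltn_eqF // addr0.
  - by rewrite gtn_eqF // addr0.
  move=> j lt_jn; rewrite /q' addrACA.
  case: (eqVneq j i) => [->|ji].
    by rewrite (gtn_eqF (ltnSn _)) addr0 /e -zz addrC addrA !subrK.
  rewrite add0r; case: (eqVneq j i.-1) => [->|ji'].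
    by rewrite prednK // eqxx /e (addrC (z _)) addrC addrA !subrK.
  by rewrite -(prednK i_gt0) eqSS (negPf ji') addr0 zq.
have ext' : extremal s q' z'.
  split=> // q'' z'' ins''; rewrite /z'.
  by rewrite (action_replace hL1 hL2 _ i_gt0 lt_in zz z0 zn); exact: ext ins''.
(* Criticality on link [i.-1] of the new path, whose edge is [2 *: (f p - z i.-1)], contradicts the
   choice of [p] and [xi]. *)
have lt_in' : (i.-1 < n)%N by lia.
have := extremal_critical s0 ext' lt_in'; rewrite /q' eqxx orbT => /(_ _ pxi).
rewrite prednK // /z' eqxx ltn_eqF ?ltn_predL // addr0 omegaC.
have -> : z i + e - z i.-1 = 2 *: (f p - z i.-1).
  rewrite [z i + e]addrC subrK scalerBr [2 *: z i.-1]scaler_nat mulr2n.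
  by rewrite opprD addrA.
rewrite omegaZr => /eqP; rewrite oppr_eq0 mulf_eq0 pnatr_eq0 /=.
by move=> /eqP.
Qed.

End Trajectories.

Theorem mainTheorem2 (R : realType) (d k : nat) (N : topologicalType)
  (f : N -> 'rV[R]_(d + d))
  (hM : closed_immersion k f) (hLL : cond_LL k f)
  (a1 a2 : 'rV[R]_(d + d)) (W1 W2 : 'M[R]_(d + d))
  (hL1 : lagrangian W1) (hL2 : lagrangian W2) (hgp : general_position W1 W2)
  (n : nat) (hn : (2 <= n)%N) :
  exists z1 z2 : nat -> 'rV[R]_(d + d),
    [/\ osb_trajectory k f a1 W1 a2 W2 n z1, osb_nondegenerate n z1,
        osb_trajectory k f a1 W1 a2 W2 n z2, osb_nondegenerate n z2
      & exists2 i, (i <= n)%N & z1 i <> z2 i].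
Proof.
have s1 : (1 : R) != 0 by exact: oner_neq0.
have s2 : (-1 : R) != 0 by rewrite oppr_eq0.
have [q1 [z1 ext1]] := extremal_exists a1 a2 n hM hLL hL1 hL2 hgp 1.
have [q2 [z2 ext2]] := extremal_exists a1 a2 n hM hLL hL1 hL2 hgp (-1).
exists z1, z2; split; [exact: extremal_trajectory ext1
  |exact: extremal_nondegenerate ext1|exact: extremal_trajectory ext2
  |exact: extremal_nondegenerate ext2|].
(* If the two paths agree up to [n], the maximum and the minimum of the action coincide. *)
apply: contrapT => noti.
have eqz j : (j <= n)%N -> z1 j = z2 j.
  by move=> le_jn; apply: contrapT => ne; apply: noti; exists j.
have eqA := action_ext a1 a2 eqz.
have [p] := cond_LL_inhabited hLL.
have ins := inscribed_path_of f a1 a2 n hL1 hL2 hgp (fun=> p).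
set z := path_of _ _ _ _ _ _ in ins.
(* If the action were constant, the path whose midpoints all equal [f p]
   would be extremal, although it is degenerate. *)
have ext : extremal f a1 a2 W1 W2 n 1 (fun=> p) z.
  split=> // q' z' ins'.
  have := ext1.2 _ _ ins'; have := ext2.2 _ _ ins; rewrite eqA; lra.
apply: (extremal_nondegenerate hLL hL1 hL2 hgp s1 ext (i := 1)) => //.
have [_ _ mid] := ins.
(* Links 0 and 1, which exist as [2 <= n], share the midpoint [f p] and the vertex [z 1], so
   [z 0 = z 2]. *)
apply: (@addrI _ (z 1%N)); rewrite mid // addrC mid //; lia.
Qed.
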